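(* Let $(X,\varrho)$ be a complete metric space and let $U$ be a monotonically dissipative m-process acting on $X$, with bounded nonautonomous absorbing set $\mathbb B_0=\{B_0(t):t\in\mathbb R\}$ (satisfying $B_0(s)\subset B_0(t)$ for $s\le t$). The following are equivalent. (1) $U$ is asymptotically compact. (2) For every $t\in\mathbb R$, $\omega(t,B_0(t))$ is nonempty, compact and attracts $B_0(t)$, i.e. $\lim_{\tau\to-\infty}\mathrm{dist}\big(U(t,\tau;B_0(t)),\omega(t,B_0(t))\big)=0$. (3) $U$ is pullback $\omega$-limit compact. (4) There exists the backward bounded pullback attractor of $U$.
   Context: $P(X)$ is the family of nonempty subsets of $X$, $\mathcal B(X)$ the family of nonempty bounded subsets of $X$, $\mathbb R_d=\{(s,t)\in\mathbb R^2: s\ge t\}$. For a point $y$ and sets $A,B\subset X$: $\mathrm{dist}(y,B)=\inf_{x\in B}\varrho(x,y)$ and $\mathrm{dist}(A,B)=\sup_{y\in A}\mathrm{dist}(y,B)$, with $\inf\emptyset=+\infty$. An m-process on $X$ is a map $U:\mathbb R_d\times X\to P(X)$, $(t,\tau,x)\mapsto U(t,\tau;x)$, such that (i) $U(t,t;x)=\{x\}$ for all $t\in\mathbb R$, $x\in X$; (ii) $U(t,\tau;x)\subset U(t,s;U(s,\tau;x))$ for all $t\ge s\ge\tau$, $x\in X$, where $U(t,s;A)=\bigcup_{y\in A}U(t,s;y)$. No continuity is assumed. A nonautonomous set is a family $\{K(t)\subset X:t\in\mathbb R\}$; it is closed (compact, bounded) if every $K(t)$ is; it is backward bounded if $\bigcup_{t\le\tau}K(t)$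 is bounded for every $\tau\in\mathbb R$. It is pullback attracting for $U$ if $\lim_{\tau\to-\infty}\mathrm{dist}(U(t,\tau;B),K(t))=0$ for every $t\in\mathbb R$ and $B\in\mathcal B(X)$. A pullback attractor for $U$ is a nonautonomous set that is compact, pullback attracting, and minimal in the class of closed pullback attracting nonautonomous sets (i.e. $A(t)\subset C(t)$ for all $t$ for every closed pullback attracting $\{C(t)\}$). No invariance is required. $\omega(t,B)=\bigcap_{s\le t}\overline{\bigcup_{\tau\le s}U(t,\tau;B)}$. $U$ is (pullback) asymptotically compact if for every $B\in\mathcal B(X)$, $t\in\mathbb R$ and any sequences $\tau_n\to-\infty$, $\xi_n\in U(t,\tau_n;B)$, the sequence $(\xi_n)$ has a subsequence converging in $X$. $\kappa(B)=\inf\{\delta: B$ has a finite cover by balls of $X$ of diameter less than $\delta\}$ ($\inf\emptyset=+\infty$). $U$ is pullback $\omega$-limit compact if for every $B\in\mathcal B(X)$ and $t\in\mathbb R$, $\lim_{\tau\to-\infty}\kappa\big(\bigcup_{s\le\tau}U(t,s;B)\big)=0$. $U$ is dissipative if there is a bounded nonautonomous set $\{B_0(t):t\in\mathbb R\}$ (called pullback absorbing) such that for every $E\in\mathcal B(X)$ and $t\in\mathbb R$ there is $\bar\tau=\bar\tau(t,E)\le t$ with $U(t,\tau;E)\subset B_0(t)$ for all $\tau\le\bar\tau$; it is monotonically dissipative if in addition $B_0(s)\subset B_0(t)$ for every $s\le t$. *)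

(* Defs.v *)
From HB Require Import structures.
From mathcomp Require Import all_boot all_order all_algebra.
From mathcomp Require Import all_classical all_reals all_analysis.

Set Implicit Arguments.
Unset Strict Implicit.
Unset Printing Implicit Defensive.

Import Order.TTheory GRing.Theory Num.Theory.
Import numFieldNormedType.Exports.

Local Open Scope classical_set_scope.
Local Open Scope ring_scope.

(* A complete type is pointed in the library, so the space is nonempty. *)
#[short(type="completeMetricType")]
HB.structure Definition CompleteMetric (K : numDomainType) :=
  {M of CompletePseudoMetric K M & Metric K M}.

Section metric_sets.
Context {R : realType} {X : metricType R}.
Implicit Types (A B : set X) (y : X).

Definition dist_pt y B : \bar R := ereal_inf [set (mdist x y)%:E | x in B].

(* Hausdorff semidistance; the supremum is taken in \bar R, so that
   semidist set0 B = -oo.  Below, the first argument is never empty. *)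
Definition semidist A B : \bar R := ereal_sup [set dist_pt y B | y in A].

Definition metric_bounded A : Prop :=
  exists M : R, forall x y, A x -> A y -> mdist x y <= M.

Definition nonempty_bounded A : Prop := A !=set0 /\ metric_bounded A.

Definition diameter A : \bar R :=
  ereal_sup [set (mdist p.1 p.2)%:E | p in A `*` A].

Definition ball_cover (d : R) A : Prop :=
  exists (n : nat) (c : 'I_n -> X) (r : 'I_n -> R),
    (forall i, 0 < r i /\ (diameter (ball (c i) (r i)) < d%:E)%E) /\
    A `<=` \bigcup_i ball (c i) (r i).

(* Ball measure of noncompactness; \bar R-valued, with infimum +oo when no
   finite cover exists. *)
Definition kappa A : \bar R :=
  ereal_inf [set d%:E | d in [set d : R | 0 < d /\ ball_cover d A]].

Definition compact_nset (K : R -> set X) : Prop := forall t, compact (K t).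
Definition closed_nset (K : R -> set X) : Prop := forall t, closed (K t).
Definition bounded_nset (K : R -> set X) : Prop :=
  forall t, metric_bounded (K t).
Definition backward_bounded (K : R -> set X) : Prop :=
  forall tau : R, metric_bounded (\bigcup_(t in [set t | t <= tau]) K t).

End metric_sets.

Section mprocess.
Context {R : realType} {X : metricType R}.

(* [U t tau x] stands for U(t, tau; x), which is only defined for t >= tau.
   Here U is total, but its values for t < tau are unconstrained and do not
   affect any of the notions below. *)
Implicit Types (U : R -> R -> X -> set X) (K A : R -> set X) (B E : set X).

Definition image_of U (t tau : R) B : set X := \bigcup_(x in B) U t tau x.

Record is_mprocess U : Prop := IsMProcess {
  mprocess_neq0 : forall (t tau : R) x, tau <= t -> U t tau x !=set0 ;
  mprocess_id : forall (t : R) x, U t t x = [set x] ;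
  mprocess_sub : forall (t s tau : R) x, tau <= s -> s <= t ->
    U t tau x `<=` image_of U t s (U s tau x) }.

Definition attracts_at U (t : R) B (C : set X) : Prop :=
  semidist (image_of U t tau B) C @[tau --> -oo] --> 0%E.

Definition pullback_attracting U K : Prop :=
  forall t B, nonempty_bounded B -> attracts_at U t B (K t).

Definition pullback_attractor U A : Prop :=
  [/\ compact_nset A, pullback_attracting U A &
   forall C, closed_nset C -> pullback_attracting U C ->
     forall t, A t `<=` C t].

Definition omega U (t : R) B : set X :=
  \bigcap_(s in [set s | s <= t])
    closure (\bigcup_(tau in [set tau | tau <= s]) image_of U t tau B).

Definition asymptotically_compact U : Prop :=
  forall B (t : R) (tau : nat -> R) (xi : nat -> X), nonempty_bounded B ->
    (forall n, tau n <= t) -> tau @ \oo --> -oo ->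
    (forall n, image_of U t (tau n) B (xi n)) ->
    exists (phi : nat -> nat) (l : X),
      {homo phi : m n / (m < n)%N} /\ xi \o phi @ \oo --> l.

Definition omega_limit_compact U : Prop :=
  forall B (t : R), nonempty_bounded B ->
    kappa (\bigcup_(s in [set s | s <= tau]) image_of U t s B)
      @[tau --> -oo] --> 0%E.

Definition pullback_absorbing U (B0 : R -> set X) : Prop :=
  bounded_nset B0 /\
  forall E (t : R), nonempty_bounded E ->
    exists2 tau_bar : R, tau_bar <= t &
      forall tau, tau <= tau_bar -> image_of U t tau E `<=` B0 t.

Definition monotonically_dissipative U (B0 : R -> set X) : Prop :=
  pullback_absorbing U B0 /\ forall s t : R, s <= t -> B0 s `<=` B0 t.

End mprocess.

(* Main.v *)
Require Import Defs.
From mathcomp Require Import all_boot all_order all_algebra.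
From mathcomp Require Import all_classical all_reals all_analysis.
From mathcomp Require Import lra.

(** Everything happens inside one filter. For fixed [t] and [B], the sets
    containing some tail [\bigcup_(tau <= s) U(t, tau; B)] form a filter
    [pullback_filter U t B], and
    - its cluster set is [omega U t B] ([omegaE]);
    - a set [C] attracts [B] at time [t] iff every fattening of [C] belongs to
      it ([attracts_atP]);
    - asymptotic compactness, and likewise omega-limit compactness, says that
      for all [t] and all nonempty bounded [B] it is totally bounded: for
      each [e] it contains a finite union of [e]-balls.
      See [asymptotically_compact_totally_bounded],
      [totally_bounded_asymptotically_compact], [omega_limit_compactP].

    In a complete space an ultrafilter that is totally bounded converges, since
    it must contain one of the finitely many small balls and is thus Cauchy.
    Hence a totally bounded proper filter has a nonempty compact cluster set
    ([cluster_totally_bounded_neq0], [compact_cluster_totally_bounded]), whose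
    fattenings it contains ([cluster_attracts]): so asymptotic compactness makes
    each [omega U t (B0 t)] nonempty, compact and attracting.
    Conversely, a filter containing all fattenings of a compact set is totally
    bounded ([totally_bounded_attracted]): so a pullback attractor, being compact
    and attracting, forces asymptotic compactness.

    Dissipativity enters through [absorbing_filter_le]. If [s <= t], then [B]
    started early enough is inside [B0 s], hence inside [B0 t], at time [s],
    so the tails of [B] at time [t] are eventually inside the tail of [B0 t]
    beginning at [s]. The filter of [B0 t] is therefore coarser than the filter
    of any other bounded [B], and both total boundedness and attraction need
    only be known for [B0 t]: a compact [omega U t (B0 t)] attracting [B0 t] alone
    yields omega-limit compactness.

    The attractor is [A t := omega U t (B0 t)]. It is minimal because a
    closed set whose fattenings all belong to a filter contains the cluster set
    of that filter ([cluster_sub_closed]). It is backward bounded because [A s]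
    lies in the closure of [B0 s], and so in the closure of [B0 tau], for all [s <= tau]. *)

Set Implicit Arguments.
Unset Strict Implicit.
Unset Printing Implicit Defensive.

Import Order.TTheory GRing.Theory Num.Theory.
Import numFieldNormedType.Exports.

Local Open Scope classical_set_scope.
Local Open Scope ring_scope.

(** * Filters with small finite nets *)

Section totally_bounded_filters.
Context {R : realType} {X : pseudoMetricType R}.
Implicit Types (F G : set_system X) (A C : set X) (e : R).

Definition fattening e C : set X := \bigcup_(c in C) ball c e.

(** The centres are not required to lie in any particular set, so the notion
    passes to finer filters. *)
Definition totally_bounded_filter F : Prop :=
  forall e, 0 < e -> exists s : seq X, F (fattening e [set` s]).

Lemma totally_bounded_filterS F G :
  F `<=` G -> totally_bounded_filter F -> totally_bounded_filter G.
Proof. by move=> FG tbF e /tbF[s Fs]; exists s; exact: FG. Qed.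

Lemma fattening_fattening d e C :
  fattening d (fattening e C) `<=` fattening (e + d) C.
Proof.
by move=> x [y [c Cc cy] yx]; exists c => //; exact: ball_triangle yx.
Qed.

Lemma closure_fattening e A : 0 < e -> closure A `<=` fattening e A.
Proof.
move=> e0 x /(_ _ (nbhsx_ballx x e e0))[y [Ay xy]].
by exists y => //; exact: ball_sym.
Qed.

(** Otherwise the sets left uncovered by finitely many [e]-balls generate a
    proper filter on [C]; a cluster point [p] of it would be adherent to the
    complement of [ball p e]. *)
Lemma compact_finite_net C e :
  compact C -> 0 < e -> exists s : seq X, C `<=` fattening e [set` s].
Proof.
move=> cC e0; apply: contrapT => /forallNP noS.
pose G := filter_from [set: seq X] (fun s => C `\` fattening e [set` s]).
have FG : Filter G.
  apply: filter_from_filter; first by exists [::].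
  move=> s1 s2 _ _; exists (s1 ++ s2) => //.
  move=> x [Cx nx]; split; split=> // -[c cs cx]; apply: nx; exists c => //=;
    by move: cs => /=; rewrite mem_cat => ->; rewrite ?orbT.
have PG : ProperFilter G.
  apply: filter_from_proper => s _.
  have /nonsubset[x [Cx nx]] := noS s; by exists x.
have GC : G C by exists [::] => // x [].
have [p [Cp /(_ (C `\` fattening e [set` [:: p]]) (ball p e))]] := cC G PG GC.
case; [by exists [:: p]|exact: nbhsx_ballx|].
by move=> x [[_ nx] px]; apply: nx; exists p => //=; rewrite mem_head.
Qed.

Lemma totally_bounded_attracted F C : Filter F -> compact C ->
  (forall e, 0 < e -> F (fattening e C)) -> totally_bounded_filter F.
Proof.
move=> FF cC FC e e0.
have e20 : 0 < e / 2 by rewrite divr_gt0.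
have [s Cs] := compact_finite_net cC e20; exists s.
apply: filterS (FC _ e20) => x [c /Cs sc cx].
by rewrite [e]splitr; apply: fattening_fattening; exists c.
Qed.

Lemma cluster_sub_closed F C : closed C ->
  (forall e, 0 < e -> F (fattening e C)) -> cluster F `<=` C.
Proof.
move=> clC FC p Fp; apply: clC => A /nbhs_ballP[e /= e0 eA].
have e20 : 0 < e / 2 by rewrite divr_gt0.
have [y [[c Cc cy] py]] := Fp _ _ (FC _ e20) (nbhsx_ballx p _ e20).
exists c; split => //; apply: eA.
by rewrite [e]splitr; apply: ball_triangle py _; exact: ball_sym.
Qed.

(** The first countability of the space is used here: the [n]-th index is chosen
    in the ball of radius [1 / (n + 1)] and beyond the previous one. *)
Lemma cluster_subseq (xi : nat -> X) (l : X) : cluster (xi @ \oo) l ->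
  exists2 phi : nat -> nat,
    {homo phi : m n / (m < n)%N} & xi \o phi @ \oo --> l.
Proof.
move=> cl.
have next (nm : nat * nat) : exists k : nat,
    (nm.2 < k)%N /\ ball l (nm.1.+1%:R^-1 : R) (xi k).
  have tail_xi : (xi @ \oo) [set xi k | k in [set k | (nm.2 < k)%N]].
    by exists nm.2.+1 => // k /= nk; exists k.
  have r0 : 0 < nm.1.+1%:R^-1 :> R by rewrite invr_gt0.
  have [_ [[k /= nk <-] lk]] := cl _ _ tail_xi (nbhsx_ballx l _ r0).
  by exists k.
have [g gP] := choice next.
pose phi := fix phi n := if n is m.+1 then g (n, phi m) else g (0%N, 0%N).
exists phi.
  apply: homo_ltn => [|n]; first exact: ltn_trans.
  by have [] := gP (n.+1, phi n).
apply/cvg_ballP => e e0.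
have := near_infty_natSinv_lt (PosNum e0); apply: filterS => n /= /ltW ne.
apply: le_ball ne _ _.
by case: n => [|n]; [have [] := gP (0, 0)|have [] := gP (n.+1, phi n)].
Qed.

End totally_bounded_filters.

(** * Cluster sets in complete spaces *)

Section complete_clusters.
Context {R : realType} {X : completePseudoMetricType R}.
Implicit Types (F G : set_system X).

(** An ultrafilter containing a finite union contains one of its members, so
    total boundedness provides a small ball for every radius. *)
Lemma ultra_totally_bounded_cvg G :
  UltraFilter G -> totally_bounded_filter G -> exists p : X, G --> p.
Proof.
move=> UG tbG; suff /cauchy_cvg/cvg_ex : cauchy G by [].
apply: cauchy_exP => e e0; have [s] := tbG e e0.
elim: s => [|c s IH] Gs.
  have [x [c]] := filter_ex Gs; by rewrite /= in_nil.
have [Gc|Gc] := in_ultra_setVsetC (ball c e) UG; first by exists c.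
apply: IH; apply: filterS2 Gs Gc => x [d /= + dx] ncx.
by rewrite in_cons => /predU1P[dc|ds]; [move: dx; rewrite dc|exists d].
Qed.

Lemma cluster_totally_bounded_neq0 F :
  ProperFilter F -> totally_bounded_filter F -> cluster F !=set0.
Proof.
move=> PF tbF; have [G [UG FG]] := ultraFilterLemma PF.
have [p Gp] := ultra_totally_bounded_cvg UG (totally_bounded_filterS FG tbF).
exists p; rewrite cluster_cvgE; exists G => //; exact: ultra_proper.
Qed.

(** An ultrafilter on the cluster set inherits the finite nets of [F], at twice
    the radius because cluster points are only in the closure of the nets. *)
Lemma compact_cluster_totally_bounded F :
  Filter F -> totally_bounded_filter F -> compact (cluster F).
Proof.
move=> FF tbF; rewrite compact_ultra => G UG GF.
have [p Gp] : exists p : X, G --> p.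
  apply: ultra_totally_bounded_cvg => e e0.
  have e20 : 0 < e / 2 by rewrite divr_gt0.
  have [s Fs] := tbF _ e20; exists s; apply: filterS GF.
  rewrite clusterE => x /(_ _ Fs) /(closure_fattening e20).
  by rewrite [in X in _ -> X](splitr e); exact: fattening_fattening.
exists p; split=> //; have clF : closed (cluster F).
  by rewrite clusterE; apply: closed_bigI => A _; exact: closed_closure.
by apply: clF => A /Gp GA; have [x []] := filter_ex (filterI GF GA); exists x.
Qed.

(** If [F] missed a fattening of its cluster set, the trace of [F] on the
    complement would be a proper, totally bounded filter, and its cluster points
    would be cluster points of [F] away from the cluster set. *)
Lemma cluster_attracts F e : ProperFilter F -> totally_bounded_filter F ->
  0 < e -> F (fattening e (cluster F)).
Proof.
move=> PF tbF e0; apply: contrapT => nF.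
pose G := filter_from F (fun P => P `\` fattening e (cluster F)).
have FG : Filter G.
  apply: filter_from_filter; first by exists setT; exact: filterT.
  move=> P Q FP FQ; exists (P `&` Q); first exact: filterI.
  by move=> x [[Px Qx] nx].
have PG : ProperFilter G.
  apply: filter_from_proper => P FP; apply: contrapT => /nonemptyPn.
  rewrite -subset0 => P0; apply: nF; apply: filterS FP => x Px.
  by apply: contrapT => nx; case: (P0 x).
have FsubG : F `<=` G by move=> P FP; exists P => // x [].
have tbG := totally_bounded_filterS FsubG tbF.
have [p Gp] := cluster_totally_bounded_neq0 PG tbG.
have Fp : cluster F p by move=> P Q FP; exact: Gp (FsubG _ FP).
have [x [[_ nx] px]] : (setT `\` fattening e (cluster F)) `&` ball p e !=set0.
  apply: Gp; last exact: nbhsx_ballx.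
  by exists setT => //; exact: filterT.
by apply: nx; exists p.
Qed.

End complete_clusters.

(** * The pullback filter of a process *)

Lemma cvge0P {T : Type} {R : realType} (F : set_system T) {FF : Filter F}
    (f : T -> \bar R) : (\forall x \near F, (0 <= f x)%E) ->
  (f x @[x --> F] --> 0%E) <->
  (forall e : R, 0 < e -> \forall x \near F, (f x < e%:E)%E).
Proof.
move=> f0; split=> [fF e e0|fF A [e /= e0 eA]].
  have : nbhs (0%E : \bar R) [set y | (y < e%:E)%E].
    by exists e => //= r /=; rewrite sub0r normrN lte_fin => /ltr_normlW.
  exact: fF.
rewrite nbhs_filterE /=; apply: filterS2 f0 (fF _ e0) => x /=.
case: (f x) => [r| |]//=; rewrite ?lee_fin ?lte_fin => r0 re.
by apply: (eA r); rewrite /= sub0r normrN ger0_norm.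
Qed.

Section pullback_filter.
Context {R : realType} {X : metricType R}.
Implicit Types (U : R -> R -> X -> set X) (B C : set X).

(** Restricting to [s <= t] keeps every tail in the range of times where the
    process axioms give information. *)
Definition pullback_filter U (t : R) B : set_system X :=
  filter_from [set s | s <= t]
    (fun s => \bigcup_(tau in [set tau | tau <= s]) image_of U t tau B).

#[global] Instance pullback_filter_filter U t B : Filter (pullback_filter U t B).
Proof.
apply: filter_from_filter; first by exists t; exact: lexx.
move=> r s /= rt st; exists (Num.min r s); first by rewrite /= ge_min rt.
by move=> x [tau /=]; rewrite le_min => /andP[tr ts] Ux; split; exists tau.
Qed.

Lemma image_of_neq0 U (t tau : R) B :
  is_mprocess U -> B !=set0 -> tau <= t -> image_of U t tau B !=set0.
Proof.
move=> mU [x Bx] taut; have [y Uy] := mprocess_neq0 mU x taut.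
by exists y, x.
Qed.

Lemma pullback_filter_proper U t B :
  is_mprocess U -> B !=set0 -> ProperFilter (pullback_filter U t B).
Proof.
move=> mU B0; apply: filter_from_proper => s /= st.
have [y Uy] := image_of_neq0 mU B0 st.
by exists y, s => //=.
Qed.

Lemma omegaE U t B : omega U t B = cluster (pullback_filter U t B).
Proof.
rewrite clusterE; apply/seteqP; split=> [x ox A [s st /closure_subset]|x cx s st].
  by apply; exact: ox.
by apply: cx; exists s.
Qed.

Lemma mdist_ball (x y : X) e : ball x e y = (mdist x y < e) :> Prop.
Proof. by rewrite ballEmdist. Qed.

Lemma semidist_ge0 B C : B !=set0 -> (0 <= semidist B C)%E.
Proof.
move=> [y By]; apply: (@le_trans _ _ (dist_pt y C)).
  by apply/ereal_infP => _ [x _ <-]; rewrite lee_fin mdist_ge0.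
by apply: ereal_sup_ubound; exists y.
Qed.

(** As [B] is nonempty the semidistance is nonnegative at times before [t], so
    convergence to 0 is only an upper bound. A semidistance below [e] forces an
    inclusion in the fattening of radius [e], and such an inclusion bounds the
    semidistance by [e], with equality possible: hence the radius [e / 2] in the
    converse. *)
Lemma attracts_atP U t B C : is_mprocess U -> B !=set0 ->
  attracts_at U t B C <->
  forall e, 0 < e -> pullback_filter U t B (fattening e C).
Proof.
move=> mU Bneq0; rewrite /attracts_at cvge0P; last first.
  exists t; split=> [|tau /ltW taut]; first exact: num_real.
  by apply: semidist_ge0; exact: image_of_neq0.
split=> UC e e0.
  have [M [_ MC]] := UC e e0.
  (* The eventual bound holds for [tau < M] only, hence the shift by 1. *)
  exists (Num.min t (M - 1)); first by rewrite /= ge_min lexx.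
  move=> y [tau /=]; rewrite le_min => /andP[_ tauM] Uy.
  have /MC Ue : tau < M by rewrite (le_lt_trans tauM)// ltrBlDr ltrDl.
  have : (dist_pt y C < e%:E)%E.
    by apply: le_lt_trans Ue; apply: ereal_sup_ubound; exists y.
  move=> /ereal_inf_lt[_ [x Cx <-]]; rewrite lte_fin -mdist_ball => xy.
  by exists x.
have e20 : 0 < e / 2 by rewrite divr_gt0.
have [s st sC] := UC _ e20.
exists s; split=> [|tau /ltW taus]; first exact: num_real.
apply: (@le_lt_trans _ _ (e / 2)%:E).
  apply: ge_ereal_sup => _ [y Uy <-].
  have [x Cx xy] : fattening (e / 2) C y by apply: sC; exists tau.
  apply: ge_ereal_inf; exists (mdist x y)%:E; first by exists x.
  by rewrite lee_fin ltW// -mdist_ball.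
by rewrite lte_fin ltr_pdivrMr// ltr_pMr// ltr1n.
Qed.

(** Monotonicity of [B0] is what makes the absorption at the earlier time [s]
    useful at time [t]: the image of [B] at time [s] enters [B0 s], which is a
    subset of [B0 t], and is then carried from [s] to [t] as a part of [B0 t]. *)
Lemma absorbing_filter_le U (B0 : R -> set X) t B :
  is_mprocess U -> monotonically_dissipative U B0 -> nonempty_bounded B ->
  pullback_filter U t (B0 t) `<=` pullback_filter U t B.
Proof.
move=> mU [[_ absB0] monB0] bB P [s /= st sP].
have [r rs rB0] := absB0 B s bB.
exists r => [|y [tau /= taur [x Bx Uy]]]; first exact: le_trans rs st.
have [z Uz Uyz] := mprocess_sub mU (le_trans taur rs) st Uy.
apply: sP; exists s => //=; exists z => //.
by apply: (monB0 _ _ st); apply: (rB0 _ taur); exists x.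
Qed.

(** Nonemptiness comes from absorbing a single point [x]. *)
Lemma nonempty_bounded_absorbing U (B0 : R -> set X) (x : X) t : is_mprocess U ->
  pullback_absorbing U B0 -> nonempty_bounded (B0 t).
Proof.
move=> mU [bB0 absB0]; split; last exact: bB0.
have b1 : nonempty_bounded [set x].
  by split; [exists x|exists 0 => _ _ -> ->; rewrite mdistxx].
have [s st sB0] := absB0 _ t b1.
have [y Uy] := image_of_neq0 mU b1.1 st.
by exists y; exact: sB0 Uy.
Qed.

(** Failure at radius [e] allows, for every finite list of points, a choice of
    points of arbitrarily late tails at distance at least [e] from the list.
    Iterating produces an [e]-separated sequence, which has no convergent
    subsequence. *)
Lemma asymptotically_compact_totally_bounded U t B :
  asymptotically_compact U -> nonempty_bounded B ->
  totally_bounded_filter (pullback_filter U t B).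
Proof.
move=> acU bB e e0; apply: contrapT => /forallNP noS.
have far (ns : nat * seq X) : exists ty : R * X,
    [/\ ty.1 <= t - ns.1%:R, image_of U t ty.1 B ty.2 &
        ~ fattening e [set` ns.2] ty.2].
  apply: contrapT => /forallNP nfar; apply: (noS ns.2).
  exists (t - ns.1%:R); first by rewrite /= gerBl.
  move=> y [tau /= tauns Uy]; apply: contrapT => ny.
  by apply: (nfar (tau, y)).
have [g gP] := choice far.
(* [hist n] lists the [n] points chosen before the [n]-th one. *)
pose hist := fix hist n :=
  if n is m.+1 then (g (m, hist m)).2 :: hist m else [::].
pose tau n := (g (n, hist n)).1; pose xi n := (g (n, hist n)).2.
have xi_hist m n : (m < n)%N -> xi m \in hist n.
  elim: n => // n IH; rewrite ltnS leq_eqVlt => /predU1P[->|/IH mn].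
    exact: mem_head.
  by rewrite in_cons mn orbT.
have taut n : tau n <= t - n%:R by have [] := gP (n, hist n).
have tauNy : tau @ \oo --> -oo.
  apply/cvgrNyPle => A; have := nbhs_infty_ger (t - A); apply: filterS => n An.
  by rewrite (le_trans (taut n))// lerBlDr -lerBlDl.
have tau_le n : tau n <= t by rewrite (le_trans (taut n))// gerBl.
have Uxi n : image_of U t (tau n) B (xi n) by have [] := gP (n, hist n).
have [phi [l [phi_incr /cvg_ballP xil]]] := acU B t tau xi bB tau_le tauNy Uxi.
have e20 : 0 < e / 2 by rewrite divr_gt0.
have [n _ nl] := xil _ e20.
have [_ _] := gP (phi n.+1, hist (phi n.+1)); apply.
exists (xi (phi n)); first exact/xi_hist/phi_incr.
rewrite [e]splitr; apply: ball_triangle (nl n.+1 _) => /=; last exact: leqnSn.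
by apply: ball_sym; apply: nl => /=.
Qed.

(** A ball of diameter less than [d] lies in the ball of radius [d] with the same
    centre, and a ball of radius [e] has diameter at most [2 * e]; so covers by
    balls of small diameter and by balls of small radius are interchangeable. *)
Lemma omega_limit_compactP U : omega_limit_compact U <->
  forall t B, nonempty_bounded B ->
    totally_bounded_filter (pullback_filter U t B).
Proof.
pose tail t B s := \bigcup_(r in [set r | r <= s]) image_of U t r B.
have kappaP t B : kappa (tail t B s) @[s --> -oo] --> 0%E <->
    forall e, 0 < e -> \forall s \near -oo, (kappa (tail t B s) < e%:E)%E.
  apply: cvge0P; near=> s.
  by apply/ereal_infP => _ [d [d0 _] <-]; rewrite lee_fin ltW.
split=> [olc t B bB e e0|tb B t bB].
  have [M [_ Me]] := (kappaP t B).1 (olc B t bB) e e0.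
  (* The eventual bound holds for [s < M] only, hence the shift by 1. *)
  pose s := Num.min t (M - 1).
  have /Me : s < M by rewrite gt_min orbC ltrBlDr ltrDl ltr01.
  move=> /ereal_inf_lt[_ [d [d0 [n [c [r [cr tailc]]]]] <-]].
  rewrite lte_fin => de; exists (map c (enum 'I_n)).
  exists s; first by rewrite /= ge_min lexx.
  move=> y /tailc[i _ iy]; have [r0 diam] := cr i.
  exists (c i); first by apply/mapP; exists i => //; rewrite mem_enum.
  rewrite mdist_ball; apply: lt_trans de; rewrite -lte_fin.
  apply: le_lt_trans diam; apply: ereal_sup_ubound.
  by exists (c i, y) => //; split=> //=; exact: ballxx.
apply/kappaP => e e0.
(* Balls of radius [e / 4] have diameter at most [e / 2]; any value strictly
   between [e / 2] and [e], here [3 * e / 4], bounds the measure. *)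
have e40 : 0 < e / 4 by rewrite divr_gt0.
have [cs [s st tailcs]] := tb t B bB _ e40.
exists s; split=> [|r /ltW rs]; first exact: num_real.
apply: (@le_lt_trans _ _ (e * (3 / 4))%:E); last first.
  by rewrite lte_fin; lra.
apply: ereal_inf_lbound; exists (e * (3 / 4)) => //.
split; first by rewrite mulr_gt0// divr_gt0.
exists (size cs), (tnth (in_tuple cs)), (fun=> e / 4); split=> [i|y [q /= qr Uy]].
  split=> //; apply: (@le_lt_trans _ _ (e / 2)%:E); last by rewrite lte_fin; lra.
  apply: ge_ereal_sup => _ [[x y] [/= cx cy] <-]; rewrite lee_fin ltW//.
  rewrite -mdist_ball (_ : e / 2 = e / 4 + e / 4); last by lra.
  by apply: ball_triangle cy; exact: ball_sym.
have [c /= ccs cy] : fattening (e / 4) [set` cs] y.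
  by apply: tailcs; exists q => //=; exact: le_trans qr rs.
have /tnthP[i ci] : c \in in_tuple cs by [].
by exists i => //; rewrite -ci.
Unshelve. all: by end_near. Qed.

Lemma metric_bounded_closure B : metric_bounded B -> metric_bounded (closure B).
Proof.
move=> [M BM]; exists (M + 2) => x y.
move=> /(closure_fattening (@ltr01 R))[x' Bx' x'x].
move=> /(closure_fattening (@ltr01 R))[y' By' y'y].
move: x'x y'y; rewrite !mdist_ball => x'x y'y.
have := metric_triangle x x' y; have := metric_triangle x' y' y.
have := BM _ _ Bx' By'; rewrite (metric_sym x x'); lra.
Qed.

End pullback_filter.

(** * The equivalences *)

Section complete_process.
Context {R : realType} {X : completeMetricType R}.
Implicit Types (U : R -> R -> X -> set X) (B : set X).

(** The filter generated by [xi] refines the pullback filter, so it is totally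
    bounded and clusters. *)
Lemma totally_bounded_asymptotically_compact U :
  (forall t B, nonempty_bounded B ->
     totally_bounded_filter (pullback_filter U t B)) ->
  asymptotically_compact U.
Proof.
move=> tb B t tau xi bB taut tauNy Uxi.
have Fxi : pullback_filter U t B `<=` xi @ \oo.
  move=> P [s st sP].
  have tau_s : \forall n \near \oo, tau n <= s by move/cvgrNyPle: tauNy; exact.
  by apply: filterS tau_s => n ns; apply: sP; exists (tau n).
have tbxi := totally_bounded_filterS Fxi (tb t B bB).
have [l] := cluster_totally_bounded_neq0 (fmap_proper_filter _ _) tbxi.
by move=> /cluster_subseq[phi phi_incr phil]; exists phi, l.
Qed.

End complete_process.

Theorem theorem3p9 (R : realType) (X : completeMetricType R)
    (U : R -> R -> X -> set X) (B0 : R -> set X) :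
  is_mprocess U ->
  monotonically_dissipative U B0 ->
  [<-> asymptotically_compact U;
       forall t : R, [/\ omega U t (B0 t) !=set0,
                         compact (omega U t (B0 t)) &
                         attracts_at U t (B0 t) (omega U t (B0 t))];
       omega_limit_compact U;
       exists A : R -> set X, pullback_attractor U A /\ backward_bounded A].
Proof.
move=> mU dU; have bB0 t := nonempty_bounded_absorbing point t mU dU.1.
have B0P t : ProperFilter (pullback_filter U t (B0 t)).
  exact: pullback_filter_proper mU (bB0 t).1.
tfae.
- move=> acU t.
  have tb := asymptotically_compact_totally_bounded t acU (bB0 t).
  rewrite omegaE; split.
  + exact: cluster_totally_bounded_neq0.
  + exact: compact_cluster_totally_bounded.
  + by apply/(attracts_atP _ _ mU (bB0 t).1) => e; exact: cluster_attracts.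
- move=> om; apply/omega_limit_compactP => t B bB.
  apply: totally_bounded_filterS (absorbing_filter_le mU dU bB) _.
  have [_ com /(attracts_atP _ _ mU (bB0 t).1) aom] := om t.
  exact: totally_bounded_attracted com aom.
- move=> /omega_limit_compactP tb; exists (fun t => omega U t (B0 t)).
  split; first split.
  + move=> t; rewrite omegaE.
    exact: compact_cluster_totally_bounded (tb _ _ _).
  + move=> t B bB; apply/(attracts_atP _ _ mU bB.1) => e e0.
    apply: (absorbing_filter_le mU dU bB); rewrite omegaE.
    exact: cluster_attracts (tb _ _ _) _.
  + move=> C clC aC t; rewrite omegaE; apply: cluster_sub_closed (clC t) _.
    exact/(attracts_atP _ _ mU (bB0 t).1)/aC.
  + move=> tau; have [M clM] := metric_bounded_closure (bB0 tau).2.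
    have inB0 s x : s <= tau -> omega U s (B0 s) x -> closure (B0 tau) x.
      move=> stau omx; have [r rs rB0] := dU.1.2 _ s (bB0 s).
      apply: closure_subset (omx _ rs) => y [q /= qr Uy].
      by apply: (dU.2 _ _ stau); exact: rB0 Uy.
    exists M => x y [r rtau xr] [s stau ys].
    by apply: clM; [exact: inB0 xr|exact: inB0 ys].
- move=> [A [[cA aA _] _]].
  apply: totally_bounded_asymptotically_compact => // t B bB.
  apply: totally_bounded_attracted (cA t) _.
  exact/(attracts_atP _ _ mU bB.1)/aA.
Qed.
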